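(* Let $d_1\ge 2$, $d_2\ge 2$. If $A$ is a $d_1$-dimensional permutation of order $n$ (a polystochastic $(0,1)$-matrix) and $B$ is a vertex of $\Omega_n^{d_2}$, then the dot product $A\cdot B$ is a vertex of $\Omega_n^{d_1+d_2-2}$, and $N(A\cdot B)=n^{d_1-2}\cdot N(B)$.
   Context: A $d$-dimensional matrix of order $n$ is an array indexed by $I_n^d=\{(\alpha_1,\dots,\alpha_d):\alpha_i\in\{0,\dots,n-1\}\}$; $N(A)$ is its number of nonzero entries. A line is the set of entries obtained by fixing all but one index position. A nonnegative matrix is polystochastic if each line sums to $1$; $\Omega_n^d$ is the polytope of $d$-dimensional polystochastic matrices of order $n$, and a vertex is an element that is not a nontrivial convex combination of other elements. For a $d_1$-dimensional matrix $A$ and a $d_2$-dimensional matrix $B$, both of order $n$, the dot product $C=A\cdot B$ is the $(d_1+d_2-2)$-dimensional matrix of order $n$ with $c_\gamma=\sum_{i=0}^{n-1}a_{\alpha,i}b_{i,\beta}$, where $\gamma=\alpha\beta$ is the concatenation of $\alpha\in I_n^{d_1-1}$ and $\beta\in I_n^{d_2-1}$. *)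

(* Defs.v *)
From mathcomp Require Import all_boot all_order all_algebra.

Set Implicit Arguments.
Unset Strict Implicit.
Unset Printing Implicit Defensive.

Import Order.TTheory GRing.Theory Num.Theory.
Local Open Scope ring_scope.

Definition mdmatrix (R : Type) (d n : nat) : Type := {ffun d.-tuple 'I_n -> R}.

Section MultidimensionalMatrices.

Variable R : realFieldType.

Definition nb_nonzero (d n : nat) (A : mdmatrix R d n) : nat :=
  #|[set a : d.-tuple 'I_n | A a != 0]|.

(* The line through the index a obtained by freeing position i. *)
Definition line (d n : nat) (i : 'I_d) (a : d.-tuple 'I_n) :
    {set d.-tuple 'I_n} :=
  [set b | [forall j, (j != i) ==> (tnth b j == tnth a j)]].

Definition polystochastic (d n : nat) (A : mdmatrix R d n) : Prop :=
  (forall a, 0 <= A a) /\ (forall i a, \sum_(b in line i a) A b = 1).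

Definition is_permutation (d n : nat) (A : mdmatrix R d n) : Prop :=
  polystochastic A /\ (forall a, A a = 0 \/ A a = 1).

(* Convex combinations have any finite number of terms. Zero weights are
   allowed: all the points combined differ from A, so such a combination is
   never trivial. *)
Definition vertex (d n : nat) (P : mdmatrix R d n -> Prop)
    (A : mdmatrix R d n) : Prop :=
  P A /\
  ~ (exists (m : nat) (w : 'I_m -> R) (X : 'I_m -> mdmatrix R d n),
       [/\ forall k, 0 <= w k,
           \sum_(k < m) w k = 1,
           forall k, P (X k) /\ X k <> A
         & forall a, A a = \sum_(k < m) w k * X k a]).

(* [index_of_seq d x s] is s as a d-tuple; the default x is not used when
   s has size d. *)
Definition index_of_seq (d n : nat) (x : 'I_n) (s : seq 'I_n) :
    d.-tuple 'I_n :=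
  [tuple nth x s j | j < d].

(* An index g of the product is the concatenation of its first d1 - 1 entries
   and its last d2 - 1 entries. The definition is meaningful for d1, d2 >= 1;
   see [dotE]. *)
Definition dot (d1 d2 n : nat) (A : mdmatrix R d1 n) (B : mdmatrix R d2 n) :
    mdmatrix R (d1 + d2 - 2) n :=
  [ffun g : (d1 + d2 - 2).-tuple 'I_n =>
     \sum_(i < n) A (index_of_seq d1 i (rcons (take (d1 - 1) g) i))
                * B (index_of_seq d2 i (i :: drop (d1 - 1) g))].

Lemma index_of_seqE (d n : nat) (x : 'I_n) (t : d.-tuple 'I_n) :
  index_of_seq d x t = t.
Proof. by apply: eq_from_tnth => j; rewrite tnth_mktuple -tnth_nth. Qed.

Lemma dotE (e1 e2 n : nat) (A : mdmatrix R e1.+1 n) (B : mdmatrix R e2.+1 n)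
    (a : e1.-tuple 'I_n) (b : e2.-tuple 'I_n)
    (g : (e1.+1 + e2.+1 - 2).-tuple 'I_n) :
  val g = val a ++ val b ->
  dot A B g = \sum_(i < n) A [tuple of rcons a i] * B [tuple of i :: b].
Proof.
move=> gE; rewrite ffunE; apply: eq_bigr => i _.
rewrite -[tval g]/(val g) gE subn1 /=.
rewrite take_size_cat ?size_tuple // drop_size_cat ?size_tuple //.
by rewrite (index_of_seqE i [tuple of rcons a i])
           (index_of_seqE i [tuple of i :: b]).
Qed.

End MultidimensionalMatrices.

(* Main.v *)
Require Import Defs.
From mathcomp Require Import all_boot all_order all_algebra.

(** A permutation [A] of dimension [m + 1] is the graph of a Latin hypercube
    [f : I_n^m -> I_n], so that [(A . B)(a b) = B (f(a) b)]. When one entry of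
    [a] runs over [I_n], the value [f(a)] runs over [I_n] exactly once; hence,
    above each line of [I_n^m], the product restricts to a copy of [B]. A convex
    decomposition of the product restricts to convex decompositions of these
    copies, which are trivial since [B] is a vertex, and the copies over one
    direction partition the index set, which gives the count. *)

Set Implicit Arguments.
Unset Strict Implicit.
Unset Printing Implicit Defensive.

Import Order.TTheory GRing.Theory Num.Theory.
Local Open Scope ring_scope.

(** * Overwriting one entry of a tuple *)

Section TupleUpdate.

Variable T : Type.

Definition tupd (d : nat) (a : d.-tuple T) (i : 'I_d) (x : T) : d.-tuple T :=
  [tuple if j == i then x else tnth a j | j < d].

Lemma tnth_tupd d (a : d.-tuple T) i x j :
  tnth (tupd a i x) j = if j == i then x else tnth a j.
Proof. by rewrite tnth_mktuple. Qed.

Lemma tupd_id d (a : d.-tuple T) i : tupd a i (tnth a i) = a.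
Proof. by apply: eq_from_tnth => j; rewrite tnth_tupd; case: eqP => [->|]. Qed.

Lemma tupd_cat_lshift d e (a : d.-tuple T) (b : e.-tuple T) i x :
  tupd [tuple of a ++ b] (lshift e i) x = [tuple of tupd a i x ++ b].
Proof.
apply: eq_from_tnth => j; rewrite tnth_tupd -(splitK j).
case: (split j) => k /=; rewrite ?tnth_lshift ?tnth_rshift ?tnth_tupd.
  by rewrite eq_lshift.
by rewrite eq_rlshift.
Qed.

Lemma tupd_cat_rshift d e (a : d.-tuple T) (b : e.-tuple T) i x :
  tupd [tuple of a ++ b] (rshift d i) x = [tuple of a ++ tupd b i x].
Proof.
apply: eq_from_tnth => j; rewrite tnth_tupd -(splitK j).
case: (split j) => k /=; rewrite ?tnth_lshift ?tnth_rshift ?tnth_tupd.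
  by rewrite eq_lrshift.
by rewrite eq_rshift.
Qed.

Lemma tupd_cons0 d y (a : d.-tuple T) x :
  tupd [tuple of y :: a] ord0 x = [tuple of x :: a].
Proof.
apply: eq_from_tnth => j; rewrite tnth_tupd.
by case: (unliftP ord0 j) => [k ->|->]; rewrite ?tnthS // eq_sym (negPf (neq_lift _ _)).
Qed.

Lemma tupd_cons_lift d y (a : d.-tuple T) i x :
  tupd [tuple of y :: a] (lift ord0 i) x = [tuple of y :: tupd a i x].
Proof.
apply: eq_from_tnth => j; rewrite tnth_tupd.
case: (unliftP ord0 j) => [k ->|->]; last by rewrite (negPf (neq_lift _ _)).
by rewrite !tnthS tnth_tupd (inj_eq lift_inj).
Qed.

Lemma tnth_rcons_lift d (a : d.-tuple T) y i :
  tnth [tuple of rcons a y] (lift ord_max i) = tnth a i.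
Proof. by rewrite !(tnth_nth y) lift_max nth_rcons size_tuple ltn_ord. Qed.

Lemma tnth_rcons_max d (a : d.-tuple T) y :
  tnth [tuple of rcons a y] ord_max = y.
Proof. by rewrite (tnth_nth y) /= nth_rcons size_tuple ltnn eqxx. Qed.

Lemma tupd_rcons_max d (a : d.-tuple T) y x :
  tupd [tuple of rcons a y] ord_max x = [tuple of rcons a x].
Proof.
apply: eq_from_tnth => j; rewrite tnth_tupd.
case: (unliftP ord_max j) => [k ->|->]; last by rewrite eqxx tnth_rcons_max.
by rewrite eq_sym (negPf (neq_lift _ _)) !tnth_rcons_lift.
Qed.

Lemma tupd_rcons_lift d (a : d.-tuple T) y i x :
  tupd [tuple of rcons a y] (lift ord_max i) x = [tuple of rcons (tupd a i x) y].
Proof.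
apply: eq_from_tnth => j; rewrite tnth_tupd.
case: (unliftP ord_max j) => [k ->|->].
  by rewrite (inj_eq lift_inj) !tnth_rcons_lift tnth_tupd.
by rewrite (negPf (neq_lift _ _)) !tnth_rcons_max.
Qed.

Lemma tuple_catP d e (g : (d + e).-tuple T) :
  exists (a : d.-tuple T) (b : e.-tuple T), g = [tuple of a ++ b].
Proof.
exists [tuple tnth g (lshift e i) | i < d], [tuple tnth g (rshift d i) | i < e].
apply: eq_from_tnth => j; rewrite -(splitK j).
by case: (split j) => k /=; rewrite ?tnth_lshift ?tnth_rshift tnth_mktuple.
Qed.

End TupleUpdate.

(** * Sums over lines and over index sets, parametrised by the entries that vary *)

Lemma sum_line (V : nmodType) d n (i : 'I_d) (a : d.-tuple 'I_n)
    (F : d.-tuple 'I_n -> V) :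
  \sum_(b in line i a) F b = \sum_(x < n) F (tupd a i x).
Proof.
rewrite (reindex_onto (tupd a i) (fun b => tnth b i)) /=.
  apply: eq_bigl => x; rewrite inE tnth_tupd !eqxx andbT.
  by apply/forallP => j; apply/implyP => /negPf nj; rewrite tnth_tupd nj.
move=> b; rewrite inE => /forallP ab; apply: eq_from_tnth => j.
rewrite tnth_tupd; case: eqP => [->//|/eqP nj].
by move/implyP: (ab j) => /(_ nj) /eqP.
Qed.

Lemma sum_tuple_cons (V : nmodType) n d (F : d.+1.-tuple 'I_n -> V) :
  \sum_g F g = \sum_(t : d.-tuple 'I_n) \sum_(x < n) F [tuple of x :: t].
Proof.
rewrite pair_big /= (reindex (fun p : d.-tuple 'I_n * 'I_n => [tuple of p.2 :: p.1])) //=.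
exists (fun g : d.+1.-tuple 'I_n => ([tuple of behead g], thead g)) => [[t x]|g] _ /=.
  by congr (_, _); apply: val_inj.
by rewrite -tuple_eta.
Qed.

Lemma sum_tuple_cat (V : nmodType) n d e (F : (d + e).-tuple 'I_n -> V) :
  \sum_g F g =
  \sum_(a : d.-tuple 'I_n) \sum_(b : e.-tuple 'I_n) F [tuple of a ++ b].
Proof.
rewrite pair_big /=.
rewrite (reindex (fun p : d.-tuple 'I_n * e.-tuple 'I_n => [tuple of p.1 ++ p.2])) //=.
apply: onW_bij; apply: inj_card_bij => [[a b] [a' b'] /(congr1 val)/= /eqP|].
  rewrite eqseq_cat ?size_tuple // => /andP[/eqP aa /eqP bb].
  by congr (_, _); apply: val_inj.
by rewrite card_prod !card_tuple expnD.
Qed.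

(** * Supports, convex decompositions and zero-one sums *)

Section Polystochastic.

Variable R : realFieldType.

Lemma nb_nonzeroE d n (A : mdmatrix R d n) :
  nb_nonzero A = (\sum_a (A a != 0%R))%N.
Proof.
by rewrite /nb_nonzero -sum1_card big_mkcond; apply: eq_bigr => a _;
   rewrite inE; case: ifP.
Qed.

(* The definition of a vertex only excludes combinations of points other than
   [A]; here the terms equal to [A] are discarded and the rest renormalised. *)
Lemma vertex_extremal d n (P : mdmatrix R d n -> Prop) (A : mdmatrix R d n)
    m (w : 'I_m -> R) (X : 'I_m -> mdmatrix R d n) :
  vertex P A -> (forall k, 0 <= w k) -> \sum_k w k = 1 -> (forall k, P (X k)) ->
  (forall a, A a = \sum_k w k * X k a) -> forall k, w k != 0 -> X k = A.
Proof.
move=> [_ nA] w0 w1 PX AE k wk; apply/eqP/negPn/negP => nk; apply: nA.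
pose s := \sum_(l | X l != A) w l.
have s0 : 0 < s.
  rewrite /s (bigD1 k) //= ltr_pwDl ?lt_def ?wk ?w0 //.
  by apply: sumr_ge0 => l _; apply: w0.
(* The number of terms is kept: a discarded term gets weight 0, and its point is replaced by [X k],
   because every point must differ from [A]. *)
exists m, (fun l => if X l != A then w l / s else 0),
  (fun l => if X l != A then X l else X k); split.
- by move=> l; case: ifP => // _; rewrite divr_ge0 // ltW.
- by rewrite -big_mkcond /= -mulr_suml divff // gt_eqF.
- by move=> l; case: ifP => [/eqP|_]; split=> //; apply/eqP.
move=> a.
have -> : \sum_l (if X l != A then w l / s else 0)
             * (if X l != A then X l else X k) a
        = s^-1 * \sum_(l | X l != A) w l * X l a.
  rewrite mulr_sumr [RHS]big_mkcond; apply: eq_bigr => l _.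
  by case: ifP; rewrite ?mul0r // mulrAC mulrC.
have sE : \sum_(l | X l == A) w l = 1 - s.
  by rewrite -w1 [in RHS](bigID (fun l => X l == A)) /= addrK.
(* The terms equal to [A] contribute [(1 - s) * A a], so the others sum to [s * A a]. *)
have /esym := AE a; rewrite (bigID (fun l => X l == A)) /=.
rewrite (eq_bigr (fun l => w l * A a)) => [|l /eqP -> //].
rewrite -mulr_suml sE mulrBl mul1r => /(canRL (addKr _)) ->.
by rewrite opprB subrK mulKf // gt_eqF.
Qed.

Lemma sum01_eq1 (I : finType) (F : I -> R) :
  (forall x, F x = 0 \/ F x = 1) -> \sum_x F x = 1 ->
  exists y, forall x, F x = (x == y)%:R.
Proof.
move=> F01 F1.
have F0 x : 0 <= F x by case: (F01 x) => ->.
have [y Fy|noF] := pickP (fun x => F x != 0); last first.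
  move: F1; rewrite big1 => [/esym/eqP|x _]; first by rewrite oner_eq0.
  by apply/eqP/negbFE/noF.
have {}Fy : F y = 1 by case: (F01 y) Fy => ->; rewrite ?eqxx.
exists y => x; case: eqP => [->//|/eqP xy].
move: F1; rewrite (bigD1 y) //= Fy => /(canRL (addKr _)); rewrite addNr => FE.
exact: (psumr_eq0P (fun i _ => F0 i) FE).
Qed.

(** * Permutations as graphs of Latin hypercubes *)

Definition latin n m (f : m.-tuple 'I_n -> 'I_n) :=
  forall a i, injective (fun x => f (tupd a i x)).

(** Each line in the last direction holds a single 1, whose position defines [f]. A line in any
    other direction also holds a single 1, so [f] cannot repeat a value when one entry varies. *)
Lemma permutation_latin n m (A : mdmatrix R m.+2 n) :
  is_permutation A ->
  exists2 f, latin f &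
    forall (a : m.+1.-tuple 'I_n) x, A [tuple of rcons a x] = (x == f a)%:R.
Proof.
move=> [[_ A1] A01].
have [f fE] : exists f : m.+1.-tuple 'I_n -> 'I_n,
    forall (a : m.+1.-tuple 'I_n) x, A [tuple of rcons a x] = (x == f a)%:R.
  apply: (fin_all_exists (P := fun (a : m.+1.-tuple 'I_n) y =>
    forall x, A [tuple of rcons a x] = (x == y)%:R)) => a.
  apply: sum01_eq1 => [x|]; first exact: A01.
  (* The last entry is overwritten, so any filler serves; [thead a] exists since [a] is nonempty. *)
  rewrite -[RHS](A1 ord_max [tuple of rcons a (thead a)]) sum_line.
  by apply: eq_bigr => x _; rewrite tupd_rcons_max.
exists f => // a i x x' fxx'.
(* The line in direction [i] at the height of the common value: both [x] and [x'] mark a 1 on it. *)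
have: \sum_z A [tuple of rcons (tupd a i z) (f (tupd a i x))] = 1.
  rewrite -[RHS](A1 (lift ord_max i) [tuple of rcons a (f (tupd a i x))]) sum_line.
  by apply: eq_bigr => z _; rewrite tupd_rcons_lift.
move/sum01_eq1 => [z|y yE]; first exact: A01.
have := yE x; have := yE x'; rewrite !fE fxx' eqxx => /esym/eqP + /esym/eqP.
by rewrite !pnatr_eq1 !eqb1 => /eqP -> /eqP ->.
Qed.

Lemma sum_latin (V : nmodType) n m (f : m.-tuple 'I_n -> 'I_n) a i (F : 'I_n -> V) :
  latin f -> \sum_x F (f (tupd a i x)) = \sum_y F y.
Proof.
by move=> lf; rewrite [RHS](reindex_inj (lf a i)).
Qed.

(** * Transfer between the product and its copies of [B] *)

Lemma polystochastic_glue n m e (f : m.-tuple 'I_n -> 'I_n) (B : mdmatrix R e.+1 n)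
    (C : mdmatrix R (m + e) n) :
  latin f -> polystochastic B ->
  (forall (a : m.-tuple 'I_n) (b : e.-tuple 'I_n),
     C [tuple of a ++ b] = B [tuple of f a :: b]) ->
  polystochastic C.
Proof.
move=> lf [B0 B1] CE; split=> [g|i g].
  by have [a [b ->]] := tuple_catP g; rewrite CE.
have [a [b ->]] := tuple_catP g; rewrite sum_line -(splitK i).
case: (split i) => j /=.
  (* A line moving an entry of [a] is carried bijectively by [f] onto a line of [B] in its first
     direction. *)
  under eq_bigr => x _ do rewrite tupd_cat_lshift CE.
  rewrite (sum_latin a j (fun y => B [tuple of y :: b])) //.
  rewrite -(B1 ord0 [tuple of f a :: b]) sum_line.
  by apply: eq_bigr => x _; rewrite tupd_cons0.
rewrite -(B1 (lift ord0 j) [tuple of f a :: b]) sum_line.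
by apply: eq_bigr => x _; rewrite tupd_cat_rshift CE tupd_cons_lift.
Qed.

(* Applied with [u] the inverse of [x |-> f (tupd a i x)], so that the product
   restricts exactly to [B]. *)
Definition restriction n m e (X : mdmatrix R (m + e) n) (a : m.-tuple 'I_n) (i : 'I_m)
    (u : 'I_n -> 'I_n) : mdmatrix R e.+1 n :=
  [ffun c : e.+1.-tuple 'I_n => X [tuple of tupd a i (u (thead c)) ++ behead c]].

Lemma restrictionE n m e (X : mdmatrix R (m + e) n) a i u y (b : e.-tuple 'I_n) :
  restriction X a i u [tuple of y :: b] = X [tuple of tupd a i (u y) ++ b].
Proof. by rewrite ffunE; congr (X _); apply: val_inj. Qed.

(** Lines in the first direction are lines of [X] in direction [i], reordered by the permutation
    [u]; the other lines are lines of [X] as they stand. *)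
Lemma polystochastic_restriction n m e (X : mdmatrix R (m + e) n) a i u :
  injective u -> polystochastic X -> polystochastic (restriction X a i u).
Proof.
move=> iu [X0 X1]; split=> [c|j c]; first by rewrite ffunE.
rewrite sum_line; have [y [b ->]] : exists y (b : e.-tuple 'I_n), c = [tuple of y :: b].
  by exists (thead c), [tuple of behead c]; apply: tuple_eta.
case: (unliftP ord0 j) => [k|] ->.
  rewrite -(X1 (rshift m k) [tuple of tupd a i (u y) ++ b]) sum_line.
  by apply: eq_bigr => x _; rewrite tupd_cons_lift tupd_cat_rshift restrictionE.
rewrite -(X1 (lshift e i) [tuple of a ++ b]) sum_line [RHS](reindex_inj iu).
by apply: eq_bigr => x _; rewrite tupd_cons0 tupd_cat_lshift restrictionE.
Qed.

Lemma vertex_glue n m e (f : m.+1.-tuple 'I_n -> 'I_n) (B : mdmatrix R e.+1 n)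
    (C : mdmatrix R (m.+1 + e) n) :
  latin f -> vertex (@polystochastic R e.+1 n) B ->
  (forall (a : m.+1.-tuple 'I_n) (b : e.-tuple 'I_n),
     C [tuple of a ++ b] = B [tuple of f a :: b]) ->
  vertex (@polystochastic R (m.+1 + e) n) C.
Proof.
move=> lf vB CE; split; first exact: polystochastic_glue lf vB.1 CE.
move=> [N [w [X [w0 w1 PX XE]]]].
have [k wk|w_eq0] := pickP (fun k => w k != 0); last first.
  move: w1; rewrite big1 => [/esym/eqP|k _]; first by rewrite oner_eq0.
  by apply/eqP/negbFE/w_eq0.
(* The contradiction is [X k = C] for a term of nonzero weight. It is checked at each index inside
   the copy of [B] through that index along the first direction. *)
case: (PX k) => _; apply; apply/ffunP => g; have [a [b ->]] := tuple_catP g.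
have iu := can_inj (f_invF (lf a ord0)).
have fK y : f (tupd a ord0 (invF (lf a ord0) y)) = y by apply: (f_invF (lf a ord0)).
have YE c : B c = \sum_l w l * restriction (X l) a ord0 (invF (lf a ord0)) c.
  have -> : c = [tuple of thead c :: [tuple of behead c]] by apply: tuple_eta.
  by under eq_bigr => l _ do rewrite restrictionE; rewrite -XE CE fK.
have := vertex_extremal vB w0 w1
  (fun l => polystochastic_restriction a ord0 iu (PX l).1) YE wk.
move/ffunP/(_ [tuple of f a :: b]); rewrite restrictionE -CE.
(* The entry [f a] of the copy sits above the original index [a]. *)
suff -> : invF (lf a ord0) (f a) = tnth a ord0 by rewrite tupd_id.
by apply: (lf a ord0); rewrite /= fK tupd_id.
Qed.

Lemma nb_nonzero_glue n m e (f : m.+1.-tuple 'I_n -> 'I_n) (B : mdmatrix R e.+1 n)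
    (C : mdmatrix R (m.+1 + e) n) :
  latin f ->
  (forall (a : m.+1.-tuple 'I_n) (b : e.-tuple 'I_n),
     C [tuple of a ++ b] = B [tuple of f a :: b]) ->
  nb_nonzero C = (n ^ m * nb_nonzero B)%N.
Proof.
move=> lf CE; rewrite !nb_nonzeroE sum_tuple_cat sum_tuple_cons.
have -> : (n ^ m)%N = #|{: m.-tuple 'I_n}| by rewrite card_tuple card_ord.
rewrite -sum_nat_const; apply: eq_bigr => t _.
rewrite sum_tuple_cons exchange_big /=; apply: eq_bigr => b _.
(* The case split supplies a filler [ord0] for the first entry, which is then overwritten. *)
case: n => [|n] in f B C lf CE t b *; first by rewrite !big_ord0.
rewrite -[RHS](sum_latin [tuple of ord0 :: t] ord0
  (fun y => nat_of_bool (B [tuple of y :: b] != 0)) lf).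
by apply: eq_bigr => x _; rewrite CE tupd_cons0.
Qed.

End Polystochastic.

Theorem theorem2 (R : realFieldType) (d1 d2 n : nat)
    (hd1 : (2 <= d1)%N) (hd2 : (2 <= d2)%N)
    (A : mdmatrix R d1 n) (B : mdmatrix R d2 n)
    (hA : is_permutation A)
    (hB : vertex (@polystochastic R d2 n) B) :
  vertex (@polystochastic R (d1 + d2 - 2) n) (dot A B) /\
  nb_nonzero (dot A B) = (n ^ (d1 - 2) * nb_nonzero B)%N.
Proof.
case: d1 hd1 A hA => [|[|m]] // _ A hA.
case: d2 hd2 B hB => [|e] // _ B hB.
have [f lf fE] := permutation_latin hA.
(* Stating the index through [val] keeps this equation meaningful when the dimension is rewritten
   below. *)
have dotAB (a : m.+1.-tuple 'I_n) (b : e.-tuple 'I_n) g :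
    val g = val a ++ val b -> dot A B g = B [tuple of f a :: b].
  move/dotE ->; rewrite (bigD1 (f a)) //= fE eqxx mul1r.
  by rewrite big1 ?addr0 // => x /negPf xf; rewrite fE xf mul0r.
have eD : (m.+2 + e.+1 - 2 = m.+1 + e)%N by rewrite subn2 /= addnS.
rewrite !subSS subn0.
(* The product is generalised together with its formula, so that the dimension in its type can be
   rewritten without a cast. *)
move: (dot A B) dotAB; rewrite eD => C CE.
have {}CE (a : m.+1.-tuple 'I_n) (b : e.-tuple 'I_n) :
    C [tuple of a ++ b] = B [tuple of f a :: b] by apply: CE.
by split; [apply: vertex_glue CE|apply: nb_nonzero_glue CE].
Qed.
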